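(* Fix $j\in\{1,2\}$. Suppose the following conditions hold: 1. $f_0(z)$ and $f_j(z)$ are twice continuously differentiable on $\mathbb R^d$. 2. (Inf-compactness) There exist constants $\alpha$ and $t_0\in(0,1]$ such that the sublevel sets $\{z\in\mathbb R^d: f_0(z)+t(f_j(z)-f_0(z))\le\alpha\}$ are nonempty and uniformly bounded for $t\in[0,t_0)$. 3. $f_0(z)$ has a unique minimizer $z_0$ over $\mathbb R^d$, and $\nabla^2 f_0(z_0)$ is positive definite. Then, as $t\downarrow 0$, $$v_j(t)=(1-t)f_0(z_0)+tf_j(z_0)-\tfrac12 t^2\,\nabla f_j(z_0)^\top\big(\nabla^2 f_0(z_0)\big)^{-1}\nabla f_j(z_0)+o(t^2),$$ $$z_j(t)=z_0-t\big(\nabla^2 f_0(z_0)\big)^{-1}\nabla f_j(z_0)+o(t),$$ where the second expansion holds for any choice of $z_j(t)$ attaining $v_j(t)$.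
   Context: $(X,Y)$ is a random pair with $X$ taking values in $\mathbb R^p$ and $Y$ in a set $\mathcal Y$; $c(z;y)$ is a real-valued cost function of a decision $z\in\mathbb R^d$ and $y\in\mathcal Y$. $R_0\subseteq\mathbb R^p$ is a region with a subpartition $R_0=R_1\cup R_2$, $R_1\cap R_2=\varnothing$. For $j=0,1,2$ let $f_j(z)=\mathbb E[c(z;Y)\mid X\in R_j]$. For $j=1,2$ and $t\in[0,1]$ let $v_j(t)=\min_{z\in\mathbb R^d}\{f_0(z)+t(f_j(z)-f_0(z))\}$ and $z_j(t)\in\arg\min_{z\in\mathbb R^d}\{f_0(z)+t(f_j(z)-f_0(z))\}$. $\nabla,\nabla^2$ denote the gradient and Hessian in $z$. *)

(* Defs.v *)
From HB Require Import structures.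
From mathcomp Require Import all_boot all_order all_algebra.
From mathcomp Require Import all_classical all_reals all_analysis.
Import Order.TTheory GRing.Theory Num.Theory.
Import numFieldNormedType.Exports.

Set Implicit Arguments.
Unset Strict Implicit.
Unset Printing Implicit Defensive.

Local Open Scope classical_set_scope.
Local Open Scope ring_scope.

(* The decision space R^d is 'cV[R]_d.  Its library norm is the sup norm,
   which has the same bounded sets, limits, little-o relations and
   differentials as the Euclidean one. *)

(* Expectation of W given the event A, meaningful when 0 < P A and W is
   P-integrable on A. *)
Definition cond_expectation (R : realType) (d : measure_display)
    (T : measurableType d) (P : probability T R) (A : set T) (W : T -> R) : R :=
  (\int[P]_(w in A) W w) / fine (P A).

Definition grad (R : realType) (d : nat) (f : 'cV[R]_d -> R) (z : 'cV[R]_d) :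
    'cV[R]_d :=
  \col_(i < d) 'D_(delta_mx i 0) f z.

Definition hess (R : realType) (d : nat) (f : 'cV[R]_d -> R) (z : 'cV[R]_d) :
    'M[R]_d :=
  \matrix_(i < d, j < d) 'D_(delta_mx i 0) ('D_(delta_mx j 0) f) z.

Definition C1 (R : realType) (d : nat) (f : 'cV[R]_d -> R) : Prop :=
  (forall z, differentiable f z) /\ continuous (grad f).

Definition C2 (R : realType) (d : nat) (f : 'cV[R]_d -> R) : Prop :=
  C1 f /\ forall i : 'I_d, C1 (fun z => grad f z i 0).

Definition posdef (R : realType) (d : nat) (H : 'M[R]_d) : Prop :=
  H^T = H /\ forall u : 'cV[R]_d, u != 0 -> 0 < (u^T *m H *m u) 0 0.

Definition is_minimizer (R : realType) (T : Type) (f : T -> R) (z : T) : Prop :=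
  forall y, f z <= f y.

(* The minimum of f whenever f has a minimizer. *)
Definition min_value (R : realType) (T : Type) (f : T -> R) : R :=
  inf (range f).

Definition blend (R : realType) (T : Type) (f0 f1 : T -> R) (t : R) (z : T) : R :=
  f0 z + t * (f1 z - f0 z).

Definition inf_compact (R : realType) (d : nat)
    (g : R -> 'cV[R]_d -> R) : Prop :=
  exists alpha t0 : R, [/\ 0 < t0, t0 <= 1,
    (forall t, 0 <= t < t0 -> exists z, g t z <= alpha) &
    (exists M : R, forall t z, 0 <= t < t0 -> g t z <= alpha -> `|z| <= M)].

(* Main.v *)
Require Import Defs.
From HB Require Import structures.
From mathcomp Require Import all_boot all_order all_algebra.
From mathcomp Require Import all_classical all_reals all_analysis.
From mathcomp Require Import ring lra.
Import Order.TTheory GRing.Theory Num.Theory.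
Import numFieldNormedType.Exports.

(** The probabilistic data only produce the functions f_0 and f_j; the theorem
is a second-order perturbation statement about the family
blend a b t = a + t (b - a) with a = f_0 and b = f_j.

For small t the sublevel set of level alpha is nonempty, closed and bounded,
hence compact, so a minimizer z_t exists and lies in a fixed ball
([bounded_sublevel_minimizer]).  On that ball b - a is bounded, so at distance
at least e from z_0 the gap of a over its minimum outweighs t (b - a) once t is
small: z_t tends to z_0 ([blend_minimizer_cvg]).

Put h = z - z_0, H the Hessian of a at z_0, g the gradient of b at z_0.  As the
gradient of a vanishes at z_0, Taylor's formula at order two for a and at order
one for b gives ([blend_quad_approx])

  blend a b t (z_0 + h) - blend a b t z_0
     = h^T H h / 2 + t g^T h + o(|h|^2 + t |h|).

The quadratic model on the right is, with u = H^-1 g, equal to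
(h + t u)^T H (h + t u) / 2 - t^2 g^T u / 2 ([quad_model_square]), and the
form of H has a positive minimum on the unit sphere ([posdef_coercive]).
Comparing the minimizer with h = 0 yields |h| = O(t), so that all errors are
o(t^2); comparing it next with h = - t u shows that (h + t u)^T H (h + t u) is
o(t^2) as well, which gives both the expansion of z_t and that of v(t)
([quad_approx_minimizer]). *)

Set Implicit Arguments.
Unset Strict Implicit.
Unset Printing Implicit Defensive.

Local Open Scope classical_set_scope.
Local Open Scope ring_scope.

(** * The sup norm and the topology of matrices *)

Section Matrices.
Context {R : realType}.

Lemma entry_le_norm m n (A : 'M[R]_(m, n)) i j : `|A i j| <= `|A|.
Proof.
rewrite [leRHS]/Num.norm /= mx_normrE.
by apply/bigmax_geP; right => /=; exists (i, j).
Qed.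

Lemma norm_le_entries m n (A : 'M[R]_(m, n)) (e : R) :
  0 <= e -> (forall i j, `|A i j| <= e) -> `|A| <= e.
Proof.
move=> e0 Ae; rewrite [leLHS]/Num.norm /= mx_normrE.
by apply/bigmax_leP; split => // -[i j] _; exact: Ae.
Qed.

Lemma norm_trmx m n (A : 'M[R]_(m, n)) : `|A^T| = `|A|.
Proof.
have le_tr p q (B : 'M[R]_(p, q)) : `|B^T| <= `|B|.
  by apply: norm_le_entries => // i j; rewrite mxE; exact: entry_le_norm.
by apply/eqP; rewrite eq_le le_tr -{1}[A]trmxK le_tr.
Qed.

Lemma norm_mulmx m n p (A : 'M[R]_(m, n)) (B : 'M[R]_(n, p)) :
  `|A *m B| <= n%:R * `|A| * `|B|.
Proof.
apply: norm_le_entries => [|i j]; first by rewrite !mulr_ge0.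
rewrite mxE (le_trans (ler_norm_sum _ _ _))// -mulrA mulr_natl.
rewrite -[X in _ *+ X]card_ord -sumr_const ler_sum// => k _.
by rewrite normrM ler_pM// entry_le_norm.
Qed.

Lemma trmx_continuous m n : continuous (@trmx R m n).
Proof.
move=> A s [P AP Ps]; exists (fun i j => P j i) => [i j|B PB].
  by have := AP j i; rewrite mxE.
by apply: Ps => i j; rewrite mxE; exact: PB.
Qed.

(** Heine-Borel for column vectors, carried over from row vectors by
transposition, which is an isometry. *)
Lemma compact_cV n (A : set 'cV[R]_n) (M : R) :
  closed A -> (forall z, A z -> `|z| <= M) -> compact A.
Proof.
move=> Acl AM.
have -> : A = trmx @` (trmx @^-1` A : set 'rV[R]_n).
  apply/seteqP; split => [z Az|_ [z /= Az <-]//].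
  by exists z^T; rewrite /= ?trmxK.
apply: continuous_compact.
  by apply: continuous_subspaceT => ?; exact: trmx_continuous.
apply: bounded_closed_compact.
  exists M; split; first exact: num_real.
  by move=> x Mx z /AM; rewrite norm_trmx => /le_trans; apply; exact: ltW.
by apply: preimage_closed => // ? _; exact: trmx_continuous.
Qed.

Lemma mulmx_continuous {m n p} (A : 'M[R]_(m, n)) :
  continuous (mulmx A : 'M[R]_(n, p) -> _).
Proof.
move=> B; apply/(@cvgrPdist_lt _ _ _ (nbhs B)) => e e0.
have K0 : 0 < n%:R * `|A| + 1 by rewrite ltr_wpDl// mulr_ge0.
near=> C.
rewrite -mulmxBr (le_lt_trans (norm_mulmx _ _))//.
apply: (@le_lt_trans _ _ ((n%:R * `|A| + 1) * `|B - C|)).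
  by rewrite ler_wpM2r// lerDl.
rewrite mulrC -ltr_pdivlMr//; near: C.
by apply: (@cvgr_dist_lt _ _ _ (nbhs B) _ id B) => //; rewrite divr_gt0.
Unshelve. all: by end_near. Qed.

End Matrices.

(** * Inner product and positive definite forms *)

Section Dot.
Context {R : realType} {d : nat}.
Implicit Types u v w : 'cV[R]_d.

Definition dot u v : R := (u^T *m v) 0 0.

Lemma dotE u v : dot u v = \sum_i u i 0 * v i 0.
Proof. by rewrite /dot mxE; apply: eq_bigr => i _; rewrite mxE. Qed.

Lemma dotC u v : dot u v = dot v u.
Proof. by rewrite !dotE; apply: eq_bigr => i _; rewrite mulrC. Qed.

Lemma dot0l v : dot 0 v = 0.
Proof. by rewrite /dot trmx0 mul0mx mxE. Qed.

Lemma dot0r v : dot v 0 = 0.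
Proof. by rewrite dotC dot0l. Qed.

Lemma dotDr u v w : dot u (v + w) = dot u v + dot u w.
Proof. by rewrite /dot mulmxDr mxE. Qed.

Lemma dotZr c u v : dot u (c *: v) = c * dot u v.
Proof. by rewrite /dot -scalemxAr mxE. Qed.

Lemma dotNr u v : dot u (- v) = - dot u v.
Proof. by rewrite /dot mulmxN mxE. Qed.

Lemma dotDl u v w : dot (u + v) w = dot u w + dot v w.
Proof. by rewrite dotC dotDr !(dotC w). Qed.

Lemma dotZl c u v : dot (c *: u) v = c * dot u v.
Proof. by rewrite dotC dotZr dotC. Qed.

Lemma dotNl u v : dot (- u) v = - dot u v.
Proof. by rewrite dotC dotNr dotC. Qed.

Lemma dot_mulmxr (H : 'M[R]_d) u v : dot u (H *m v) = dot (H^T *m u) v.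
Proof. by rewrite /dot trmx_mul trmxK mulmxA. Qed.

Lemma dot_norm u v : `|dot u v| <= d%:R * `|u| * `|v|.
Proof.
rewrite (le_trans (entry_le_norm _ _ _))// (le_trans (norm_mulmx _ _))//.
by rewrite norm_trmx.
Qed.

Lemma quad_continuous (H : 'M[R]_d) : continuous (fun u => dot u (H *m u)).
Proof.
under eq_fun do rewrite dotE.
apply: continuous_big => [|i _ u]; first exact: add_continuous.
apply: continuousM; first exact: coord_continuous.
apply: (@continuous_comp _ _ _ (mulmx H) (fun w : 'cV[R]_d => w i 0)).
  exact: mulmx_continuous.
exact: coord_continuous.
Qed.

(** A row vector in the kernel of H would be a zero of the form. *)
Lemma posdef_unitmx (H : 'M[R]_d) : posdef H -> H \in unitmx.
Proof.
move=> [Hsym Hpos]; rewrite -row_free_unit; apply: inj_row_free => v vH0.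
apply/eqP; apply: contraT => v0.
have /Hpos : v^T != 0 by rewrite trmx_eq0.
by rewrite trmxK vH0 mul0mx mxE ltxx.
Qed.

(** On the compact unit sphere the form attains a positive minimum mu, and both
sides are homogeneous of degree two.  When d = 0 the sphere is empty and any mu
is suitable. *)
Lemma posdef_coercive (H : 'M[R]_d) : posdef H ->
  exists2 mu : R, 0 < mu & forall u, mu * `|u| ^+ 2 <= dot u (H *m u).
Proof.
move=> [_ Hpos]; pose S := [set u : 'cV[R]_d | `|u| = 1].
have Spos u : S u -> 0 < dot u (H *m u).
  move=> Su; rewrite /dot mulmxA; apply: Hpos.
  by rewrite -normr_eq0 Su oner_eq0.
have Scl : closed S.
  apply: (@preimage_closed _ _ (@Num.norm _ 'cV[R]_d) [set 1 : R]) => [? _|].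
    exact: norm_continuous.
  exact: closed_eq.
have [mu mu0 Hmu] : exists2 mu : R, 0 < mu &
    forall u, S u -> mu <= dot u (H *m u).
  have [S0|/nonemptyPn S0] := pselect (S !=set0); last first.
    by exists 1 => // u; rewrite S0.
  have Sco : compact S by apply: (@compact_cV _ _ _ 1) => // u ->.
  have [c /set_mem Sc cmin] := compact_EVT_min S0 Sco
    (continuous_subspaceT (@quad_continuous H)).
  exists (dot c (H *m c)); first exact: Spos.
  by move=> u Su; apply: cmin; rewrite inE.
exists mu => // u; have [->|u0] := eqVneq u 0.
  by rewrite normr0 expr0n mulr0 /= dot0l.
have nu : 0 < `|u| by rewrite normr_gt0.
have /Hmu : S (`|u|^-1 *: u).
  by rewrite /S /= normrZ ger0_norm ?invr_ge0// mulVf// gt_eqF.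
rewrite -scalemxAr dotZr dotZl mulrA -expr2 exprVn.
move=> /(ler_wpM2r (sqr_ge0 `|u|)).
by rewrite mulrAC mulVf ?mul1r// sqrf_eq0 gt_eqF.
Qed.

End Dot.

(** * Taylor expansions at a point *)

Section Taylor.
Context {R : realType} {d : nat}.
Implicit Types (f : 'cV[R]_d -> R) (z h : 'cV[R]_d).

(** The differential is linear, so its values on the canonical basis, which are
the entries of the gradient, determine it. *)
Lemma diff_grad f z h : differentiable f z -> 'd f z h = dot (grad f z) h.
Proof.
move=> df; rewrite dotE.
have -> : h = \sum_i h i 0 *: delta_mx i 0.
  rewrite {1}[h]matrix_sum_delta; apply: eq_bigr => i _.
  by rewrite big_ord1.
rewrite linear_sum /=; apply: eq_bigr => i _.
rewrite linearZ/= -deriveE// !mxE mulrC; congr (_ * _).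
rewrite summxE (bigD1 i)//= !mxE !eqxx mulr1 big1 ?addr0// => k ki.
by rewrite !mxE eq_sym (negbTE ki) mulr0.
Qed.

Lemma taylor1 f z : differentiable f z -> forall e : R, 0 < e ->
  exists2 r : R, 0 < r & forall h, `|h| < r ->
    `|f (z + h) - f z - dot (grad f z) h| <= e * `|h|.
Proof.
move=> df e e0.
have /eqaddoP/(_ e e0)/nbhs_normP[r r0 Hr] := diff_locally df.
exists r => // h hr; rewrite -(diff_grad _ df).
have /Hr : ball_ Num.norm 0 r h by rewrite /ball_ /= sub0r normrN.
by rewrite /= !fctE /= [h + z]addrC opprD addrA.
Qed.

(** The expansion [taylor1] of each entry of the gradient, on a common ball.
With the convention that the entry (i, j) of the Hessian is D_i D_j, the
derivative of the gradient is the transpose of the Hessian. *)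
Lemma grad_taylor1 f z : (forall i, differentiable (fun y => grad f y i 0) z) ->
  forall e : R, 0 < e -> exists2 r : R, 0 < r & forall h, `|h| < r ->
    `|grad f (z + h) - grad f z - (hess f z)^T *m h| <= e * `|h|.
Proof.
move=> dgf e e0.
suff: \forall h \near (0 : 'cV[R]_d), forall i : 'I_d,
    `|grad f (z + h) i 0 - grad f z i 0
      - dot (grad (fun y => grad f y i 0) z) h|
      <= e * `|h|.
  move=> /nbhs_normP[r r0 Hr]; exists r => // h hr.
  apply: norm_le_entries => [|i j]; first by rewrite mulr_ge0// ltW.
  rewrite ord1.
  have /Hr/(_ i) : ball_ Num.norm 0 r h by rewrite /ball_ /= sub0r normrN.
  congr (`|_| <= _); rewrite !mxE dotE; congr (_ - _).
  apply: eq_bigr => k _; rewrite !mxE; congr (_ * _).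
  by congr ('D_ _ _ z); apply/funext => y; rewrite mxE.
apply: (@filter_forall _ _ _ (nbhs (0 : 'cV[R]_d))) => i.
have [r r0 Hr] := taylor1 (dgf i) e0.
have : \forall h \near (0 : 'cV[R]_d), `|h| < r.
  by apply/nbhs_normP; exists r => // h /=; rewrite sub0r normrN.
by apply: filterS => h /Hr.
Qed.

Lemma is_derive_line f z h (s : R) : differentiable f (z + s *: h) ->
  is_derive s 1 (fun s => f (z + s *: h)) (dot (grad f (z + s *: h)) h).
Proof.
move=> df; have E :
    (fun r : R => r^-1 *: (((fun s => f (z + s *: h)) \o shift s)
      (r *: 1) - f (z + s *: h)))
    = (fun r : R => r^-1 *: ((f \o shift (z + s *: h)) (r *: h)
                              - f (z + s *: h))).
  apply/funext => r /=; congr (_ *: (f _ - _)).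
  by rewrite scalerDl [_ *: 1]mulr1 addrCA.
split; first by rewrite /derivable E; exact: diff_derivable.
by rewrite /derive E -diff_grad// -deriveE.
Qed.

(** The remainder is treated as a function psi of s along the segment from z to
z + h.  Its derivative is the remainder of the first-order expansion of the
gradient at s h, applied to h, hence at most e |h|^2, and the mean value theorem
transfers this bound to psi 1 - psi 0. *)
Lemma taylor2 f z : (forall y, differentiable f y) ->
  (forall i, differentiable (fun y => grad f y i 0) z) ->
  forall e : R, 0 < e -> exists2 r : R, 0 < r & forall h, `|h| < r ->
    `|f (z + h) - f z - dot (grad f z) h - 2^-1 * dot h (hess f z *m h)|
      <= e * `|h| ^+ 2.
Proof.
move=> df dgf e e0.
have d0 : 0 < d%:R + 1 :> R by rewrite ltr_wpDl.
(* The bound |dot u v| <= d |u| |v| costs a factor d; d + 1 is used instead so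
   that the quotient makes sense for d = 0. *)
have [r r0 Hr] := grad_taylor1 dgf (divr_gt0 e0 d0).
exists r => // h hr.
pose g := grad f z; pose H := hess f z.
pose psi : R -> R := (fun s => f (z + s *: h)) - dot g h *: id
  - (2^-1 * dot h (H *m h)) *: (id ^+ 2).
pose dpsi (s : R) := dot (grad f (z + s *: h) - g - H^T *m (s *: h)) h.
have psiD (t : R) : is_derive t 1 psi (dpsi t).
  have := is_derive_line (df (z + t *: h)) => fD.
  apply: is_derive_eq.
  rewrite /dpsi dot_mulmxr dotDl dotDl !dotNl -scalemxAr dotZl.
  rewrite expr1 /GRing.scale /= !mulr1; set p := dot (H^T *m h) h.
  by set q := dot _ h; set q' := dot g h; field.
have psic : {within `[0, 1], continuous psi}.
  apply: derivable_within_continuous => s _; exact: ex_derive.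
have [s /[!in_itv] /andP[s0 s1]] := MVT ltr01 (fun s _ => psiD s) psic.
have -> : psi 1 - psi 0 =
    f (z + h) - f z - dot g h - 2^-1 * dot h (H *m h).
  rewrite /psi !fctE scale0r scale1r addr0 /GRing.scale /=.
  by set q := dot _ _; set q' := dot _ _; field.
move=> ->; rewrite subr0 mulr1.
rewrite /dpsi (le_trans (dot_norm _ _))//.
have sh : `|s *: h| <= `|h|.
  by rewrite normrZ ger0_norm ?ler_piMl// ltW.
have := Hr _ (le_lt_trans sh hr); rewrite -/g -/H => Hs.
apply: (@le_trans _ _ (d%:R * (e / (d%:R + 1) * `|h|) * `|h|)).
  rewrite ler_wpM2r// ler_wpM2l// (le_trans Hs)// ler_wpM2l//.
  by rewrite divr_ge0// ltW.
rewrite mulrA -mulrA -expr2 ler_wpM2r// mulrCA ler_piMr ?(ltW e0)//.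
by rewrite ler_pdivrMr// mul1r lerDl.
Qed.

Lemma minimizer_grad0 f z : (forall y, differentiable f y) ->
  is_minimizer f z -> grad f z = 0.
Proof.
move=> df fz; apply/colP => i; rewrite !mxE.
pose h : 'cV[R]_d := delta_mx i 0.
have D := is_derive_line (df (z + 0 *: h)).
have D0 : is_derive (0 : R) 1 (fun s : R => f (z + s *: h)) 0.
  apply: (@derive1_at_min _ _ (-1) 1).
  - by lra.
  - by move=> t _; case: (is_derive_line (df (z + t *: h))).
  - by rewrite in_itv /=; lra.
  - by move=> t _; rewrite scale0r addr0.
rewrite deriveE// diff_grad// -/h.
have := @derive_val _ _ _ _ _ _ _ D; rewrite (@derive_val _ _ _ _ _ _ _ D0).
by rewrite scale0r addr0.
Qed.

End Taylor.

(** * Existence and convergence of minimizers *)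

Section Minimizers.
Context {R : realType}.

Lemma min_valueE T (f : T -> R) z : is_minimizer f z -> min_value f = f z.
Proof.
move=> fz; apply/eqP; rewrite eq_le; apply/andP; split.
  by apply: ge_inf; [exists (f z) => _ [y _ <-]|exists z].
by apply: lb_le_inf; [exists (f z), z|move=> _ [y _ <-]].
Qed.

(** The minimum over the compact sublevel set is a global one, since f exceeds
alpha elsewhere. *)
Lemma bounded_sublevel_minimizer d (f : 'cV[R]_d -> R) (alpha M : R) :
  continuous f -> (exists z, f z <= alpha) ->
  (forall z, f z <= alpha -> `|z| <= M) -> exists z, is_minimizer f z.
Proof.
move=> fc f_alpha fM; pose S := [set z | f z <= alpha].
have Scl : closed S.
  by apply: (@preimage_closed _ _ f [set x | x <= alpha]) => // ? _; exact: fc.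
have [c /set_mem Sc cmin] := compact_EVT_min f_alpha (compact_cV Scl fM)
  (continuous_subspaceT fc).
exists c => y; have [Sy|/ltW ay] := leP (f y) alpha; last exact: le_trans ay.
by apply: cmin; rewrite inE.
Qed.

Lemma blend_continuous (T : topologicalType) (a b : T -> R) t :
  continuous a -> continuous b -> continuous (blend a b t).
Proof.
move=> ac bc z; apply: cvgD; first exact: ac.
apply: cvgM; first exact: cvg_cst.
by apply: cvgB; [exact: bc|exact: ac].
Qed.

(** Let A be the compact set of the points of norm at most M at distance at
least e from z0.  By uniqueness a exceeds a z0 on A by a fixed positive amount,
while b - a is bounded below there; hence for small t every point of A
does worse than z0. *)
Lemma blend_minimizer_cvg d (a b : 'cV[R]_d -> R) z0 (M : R) :
  continuous a -> continuous b -> is_minimizer a z0 ->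
  (forall z, is_minimizer a z -> z = z0) ->
  forall e : R, 0 < e -> exists2 r : R, 0 < r & forall t z,
    0 <= t < r -> `|z| <= M -> is_minimizer (blend a b t) z -> `|z - z0| < e.
Proof.
move=> ac bc az0 auniq e e0.
pose A := [set z : 'cV[R]_d | `|z| <= M /\ e <= `|z - z0|].
have normc : continuous (@Num.norm _ 'cV[R]_d).
  by move=> ?; exact: norm_continuous.
have Aco : compact A.
  apply: (@compact_cV _ _ _ M) => [|z []//].
  apply: closedI.
    exact: (@preimage_closed _ _ (@Num.norm _ 'cV[R]_d) [set x | x <= M]).
  apply: (@preimage_closed _ _ (fun z : 'cV[R]_d => `|z - z0|)
    [set x | e <= x]) => // z _.
  apply: (@continuous_comp _ _ _ (fun z : 'cV[R]_d => z - z0) Num.norm);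
    last exact: normc.
  by apply: (@cvgB _ _ _ (nbhs z)); [exact: cvg_id|exact: cvg_cst].
have [A0|/nonemptyPn A0] := pselect (A !=set0); last first.
  exists 1 => // t z _ zM _; rewrite ltNge; apply/negP => ez.
  by have : A z by []; rewrite A0.
have Dc : continuous (fun z => b z - a z).
  by move=> z; apply: (@cvgB _ _ _ (nbhs z)); [exact: bc|exact: ac].
have [c /set_mem [_ ec] cmin] :=
  compact_EVT_min A0 Aco (continuous_subspaceT ac).
have [p _ pmin] := compact_EVT_min A0 Aco (continuous_subspaceT Dc).
have gap : 0 < a c - a z0.
  rewrite subr_gt0 lt_neqAle az0 andbT; apply/eqP => ac0.
  have cz0 : c = z0 by apply: auniq => y; rewrite -ac0.
  by move: ec; rewrite cz0 subrr normr0 leNgt e0.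
pose K := `|b p - a p - (b z0 - a z0)| + 1.
have K0 : 0 < K by rewrite /K ltr_wpDl.
exists ((a c - a z0) / K); first by rewrite divr_gt0.
move=> t z /andP[t0]; rewrite ltr_pdivlMr// => tK zM zmin.
rewrite ltNge; apply/negP => ez.
have Az : z \in A by rewrite inE.
have := zmin z0; rewrite /blend => zz0.
have := cmin z Az; have := pmin z Az => pz cz.
have : t * (b p - a p - (b z0 - a z0)) >= - (t * K).
  rewrite -mulrN ler_wpM2l// /K.
  have := ler_norm (- (b p - a p - (b z0 - a z0))); rewrite normrN; lra.
have : t * (b p - a p) <= t * (b z - a z) by rewrite ler_wpM2l.
by lra.
Qed.

End Minimizers.

(** * Minimizers of a perturbed quadratic form *)

Section QuadraticModel.
Context {R : realType} {d : nat}.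
Context (H : 'M[R]_d) (g : 'cV[R]_d).

Definition quad_model t (h : 'cV[R]_d) := 2^-1 * dot h (H *m h) + t * dot g h.

(** The error is measured by |h|^2 + t |h| because the first term comes from the
Taylor remainder of the unperturbed function, of order two, and the second from
t times a Taylor remainder of order one. *)
Definition quad_approx (Phi : R -> 'cV[R]_d -> R) :=
  forall e : R, 0 < e -> exists2 r : R, 0 < r &
    forall t h, 0 < t < r -> `|h| < r ->
    `|Phi t h - quad_model t h| <= e * (`|h| ^+ 2 + t * `|h|).

(** Completing the square, from H u = g and the symmetry of H. *)
Lemma quad_model_square (Hpos : posdef H) t h :
  let u := invmx H *m g in
  quad_model t h =
    2^-1 * dot (h + t *: u) (H *m (h + t *: u)) - 2^-1 * t ^+ 2 * dot g u.
Proof.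
move=> u; have Hu : H *m u = g by rewrite mulKVmx// posdef_unitmx.
have Huh : dot u (H *m h) = dot g h by rewrite dot_mulmxr (proj1 Hpos) Hu.
rewrite /quad_model mulmxDr -scalemxAr Hu !dotDr !dotDl !dotZr !dotZl Huh.
rewrite (dotC h g) (dotC u g).
by set x := dot h _; set y := dot g h; set w := dot g u; field.
Qed.

(** Write m for the quadratic model and k = - t u for its minimizer.  Comparing
Phi t h with Phi t 0 = 0, coercivity gives |h| <= C t; after that the errors of
the model at h and at k add up to at most e1 B t^2, and Phi t h <= Phi t k
bounds m(h) - m(k), which is half the form H at h + t u, by the same quantity. *)
Lemma quad_approx_minimizer Phi : posdef H -> quad_approx Phi ->
  forall e : R, 0 < e -> exists2 r : R, 0 < r &
    forall t h, 0 < t < r -> `|h| < r ->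
    is_minimizer (Phi t) h ->
    `|h + t *: (invmx H *m g)| <= e * t /\
    `|Phi t h + 2^-1 * t ^+ 2 * dot g (invmx H *m g)| <= e * t ^+ 2.
Proof.
move=> Hpos Phi2 e e0; set u := invmx H *m g.
have [mu mu0 Hmu] := posdef_coercive Hpos.
pose L := d%:R * `|g|; have L0 : 0 <= L by rewrite mulr_ge0.
pose C := 1 + 4 * L / mu.
have C0 : 0 <= C by rewrite addr_ge0// divr_ge0 ?(ltW mu0)// mulr_ge0.
pose B := C ^+ 2 + C + (`|u| ^+ 2 + `|u|) + 1.
have B0 : 0 < B.
  by move: (sqr_ge0 C) (sqr_ge0 `|u|) (normr_ge0 u) C0; rewrite /B; lra.
(* The bound by mu / 4 lets coercivity absorb the quadratic error; the other
   two give the error on the value and on the minimizer respectively. *)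
have [e1 [e10 e1mu e1B e1B2]] : exists e1 : R, [/\ 0 < e1, e1 <= mu / 4,
    e1 * B * 2 <= e & e1 * B * 2 <= mu * e ^+ 2].
  exists (Num.min (mu / 4) (Num.min (e / (B * 2)) (mu * e ^+ 2 / (B * 2)))).
  have B2 : 0 < B * 2 by rewrite mulr_gt0.
  split.
  - by rewrite !lt_min !divr_gt0 ?mulr_gt0 ?exprn_gt0.
  - by rewrite ge_min lexx.
  - by rewrite -mulrA -ler_pdivlMr// !ge_min lexx orbT.
  - by rewrite -mulrA -ler_pdivlMr// !ge_min lexx !orbT.
have [r r0 Hr] := Phi2 _ e10.
have U0 : 0 < 1 + `|u| by rewrite ltr_pwDl.
(* Shrinking r keeps the competitor k = - t u inside the ball of radius r. *)
exists (r / (1 + `|u|)); first by rewrite divr_gt0.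
move=> t h /andP[t0 tr] hr hmin.
have {}tr : t * (1 + `|u|) < r by rewrite -ltr_pdivlMr.
have tu0 : 0 <= t * `|u| by rewrite mulr_ge0// ltW.
have t_r : 0 < t < r by rewrite t0 /=; lra.
have {}hr : `|h| < r.
  by rewrite (lt_le_trans hr)// ler_pdivrMr// ler_peMr ?(ltW r0)// lerDl.
pose k := - (t *: u).
have nk : `|k| = t * `|u| by rewrite normrN normrZ gtr0_norm.
have modh := Hr t h t_r hr.
have modk : `|Phi t k - quad_model t k| <= e1 * (`|k| ^+ 2 + t * `|k|).
  by apply: Hr => //; rewrite nk; lra.
have mod0 : Phi t 0 = 0.
  have := Hr t 0 t_r; rewrite normr0 => /(_ r0).
  rewrite expr0n /= !mulr0 addr0 mulr0 normr_le0 subr_eq0 => /eqP ->.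
  by rewrite /quad_model mulmx0 !dot0r !mulr0 addr0.
have hC : `|h| <= C * t.
  have [->|h0] := eqVneq h 0; first by rewrite normr0 mulr_ge0// ltW.
  have nh : 0 < `|h| by rewrite normr_gt0.
  have := hmin 0; rewrite mod0 => Phih.
  have := Hmu h; have := dot_norm g h; rewrite -/L => gh hmu.
  have tgh : t * dot g h >= - (t * (L * `|h|)).
    rewrite -mulrN ler_wpM2l ?(ltW t0)//.
    by move: gh; rewrite ler_norml => /andP[].
  have e1h : e1 * (`|h| ^+ 2 + t * `|h|) <= mu / 4 * (`|h| ^+ 2 + t * `|h|).
    by rewrite ler_wpM2r// addr_ge0 ?sqr_ge0// mulr_ge0// ltW.
  have : mu / 4 * `|h| ^+ 2 <= (mu / 4 * t + t * L) * `|h|.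
    move: modh; rewrite /quad_model ler_norml => /andP[+ _]; nra.
  rewrite expr2 mulrA ler_pM2r// => key.
  rewrite -(ler_pM2l (x := mu / 4)) ?divr_gt0// (le_trans key)//.
  rewrite le_eqVlt; apply/orP; left; apply/eqP; rewrite /C.
  by field; rewrite gt_eqF.
have errB : e1 * (`|h| ^+ 2 + t * `|h|) + e1 * (`|k| ^+ 2 + t * `|k|)
    <= e1 * B * t ^+ 2.
  rewrite -mulrDr -mulrA ler_wpM2l ?(ltW e10)// /B nk.
  have : `|h| ^+ 2 <= (C * t) ^+ 2 by rewrite ler_sqr ?nnegrE// mulr_ge0// ltW.
  have : t * `|h| <= t * (C * t) by rewrite ler_wpM2l// ltW.
  have : 0 <= t ^+ 2 by rewrite sqr_ge0.
  rewrite !exprMn; nra.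
have hk := hmin k.
have mk : quad_model t k = - (2^-1 * t ^+ 2 * dot g u).
  by rewrite quad_model_square// -/u addNr dot0l mulr0 sub0r.
have mh := quad_model_square Hpos t h; rewrite /= -/u in mh.
have := Hmu (h + t *: u); set s := `|h + t *: u|.
set q := dot (h + _) _ in mh * => sq.
have {}sq : 0 <= mu * s ^+ 2 <= q by rewrite sq mulr_ge0 ?sqr_ge0// ltW.
have t20 : 0 <= t ^+ 2 by rewrite sqr_ge0.
move: modh modk; rewrite !ler_norml mk mh => /andP[h1 h2] /andP[k1 k2].
move: sq => /andP[q0 qs].
have qB : q <= 2 * (e1 * B * t ^+ 2) by lra.
split.
  rewrite -(@ler_pXn2r _ 2) ?nnegrE ?normr_ge0 ?mulr_ge0 ?(ltW e0) ?(ltW t0)//.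
  rewrite -(ler_pM2l mu0) exprMn (le_trans qs)// (le_trans qB)//.
  by move: (ler_wpM2r t20 e1B2); lra.
have : e1 * B * 2 * t ^+ 2 <= e * t ^+ 2 by rewrite ler_wpM2r.
by move=> ?; apply/andP; split; lra.
Qed.

(** Since blend a b t = (1 - t) a + t b, the error of the model splits into the
second-order remainder of a, the first-order remainder of b multiplied by t,
and the term t h^T H h / 2, which is at most e |h|^2 / 2 for small t. *)
Lemma blend_quad_approx (a b : 'cV[R]_d -> R) z :
  (forall y, differentiable a y) ->
  (forall i, differentiable (fun y => grad a y i 0) z) ->
  grad a z = 0 -> hess a z = H -> differentiable b z -> grad b z = g ->
  quad_approx (fun t h => blend a b t (z + h) - blend a b t z).
Proof.
move=> da dga a0 aH db bg e e0.
have e2 : 0 < e / 2 by rewrite divr_gt0.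
have [ra ra0 Ha] := taylor2 da dga e2.
have [rb rb0 Hb] := taylor1 db e0.
pose K := d%:R * (d%:R * `|H|) + 1.
have K0 : 0 < K by rewrite /K ltr_wpDl// !mulr_ge0.
have QK h : `|dot h (H *m h)| <= K * `|h| ^+ 2.
  rewrite (le_trans (dot_norm _ _))//.
  rewrite (@le_trans _ _ (d%:R * `|h| * (d%:R * `|H| * `|h|)))//.
    by rewrite ler_wpM2l ?mulr_ge0//; exact: norm_mulmx.
  have -> : d%:R * `|h| * (d%:R * `|H| * `|h|)
    = d%:R * (d%:R * `|H|) * `|h| ^+ 2 by ring.
  by rewrite ler_wpM2r ?sqr_ge0// lerDl.
pose r := Num.min (Num.min 1 (e / K)) (Num.min ra rb).
exists r; first by rewrite !lt_min ltr01 divr_gt0// ra0.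
move=> t h /andP[t0]; rewrite !lt_min.
move=> /andP[/andP[t1 tK] _] /andP[_ /andP[hra hrb]].
have := Ha h hra; have := Hb h hrb.
rewrite a0 bg aH dot0l subr0.
move=> Eb Ea; rewrite /blend /quad_model.
have -> : a (z + h) + t * (b (z + h) - a (z + h)) - (a z + t * (b z - a z)) -
    (2^-1 * dot h (H *m h) + t * dot g h) =
  (1 - t) * (a (z + h) - a z - 2^-1 * dot h (H *m h)) +
  (t * (b (z + h) - b z - dot g h) - t * (2^-1 * dot h (H *m h))).
  by set q := dot _ _; set w := dot _ _; ring.
have h20 : 0 <= `|h| ^+ 2 by rewrite sqr_ge0.
have X1 : `|(1 - t) * (a (z + h) - a z - 2^-1 * dot h (H *m h))|
    <= e / 2 * `|h| ^+ 2.
  rewrite normrM ger0_norm ?subr_ge0 ?(ltW t1)//.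
  by rewrite (le_trans _ Ea)// ler_piMl// lerBlDr lerDl ltW.
have X2 : `|t * (b (z + h) - b z - dot g h)| <= t * (e * `|h|).
  by rewrite normrM gtr0_norm// ler_wpM2l// ltW.
have X3 : `|t * (2^-1 * dot h (H *m h))| <= e / 2 * `|h| ^+ 2.
  rewrite normrM gtr0_norm// normrM ger0_norm ?invr_ge0//.
  have : t * K <= e by rewrite ltW// -ltr_pdivlMr.
  have := QK h; set q := `|dot _ _|; set x := `|h| ^+ 2 in h20 * => Qx tKe.
  have : t * q <= t * (K * x) by rewrite ler_wpM2l// ltW.
  have : (t * K) * x <= e * x by rewrite ler_wpM2r.
  lra.
rewrite (le_trans (ler_normD _ _))// (le_trans (lerD X1 (ler_normB _ _)))//.
by move: (lerD X2 X3); lra.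
Qed.

End QuadraticModel.

(** * Expansion of the minimizer and of the minimum *)

Section Perturbation.
Context {R : realType} {d : nat}.
Context (a b : 'cV[R]_d -> R) (z0 : 'cV[R]_d).

(** The minimizers being confined to a ball, they enter the neighbourhood of z0
on which the quadratic model is accurate. *)
Lemma blend_minimizer_expansion (M t0 : R) :
  (forall y, differentiable a y) ->
  (forall i, differentiable (fun y => grad a y i 0) z0) ->
  (forall y, differentiable b y) ->
  is_minimizer a z0 -> (forall z, is_minimizer a z -> z = z0) ->
  posdef (hess a z0) -> 0 < t0 ->
  (forall t z, 0 <= t < t0 -> is_minimizer (blend a b t) z -> `|z| <= M) ->
  let u := invmx (hess a z0) *m grad b z0 in
  forall e : R, 0 < e -> \forall t \near 0^'+, forall z,
    is_minimizer (blend a b t) z ->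
    `|z - (z0 - t *: u)| <= e * t /\
    `|blend a b t z - (blend a b t z0 - 2^-1 * t ^+ 2 * dot (grad b z0) u)|
      <= e * t ^+ 2.
Proof.
move=> da dga db az0 auniq Hpos t00 Mbound u e e0.
have ac : continuous a by move=> y; exact: differentiable_continuous.
have bc : continuous b by move=> y; exact: differentiable_continuous.
have [r r0 Hr] := quad_approx_minimizer Hpos (blend_quad_approx da dga
  (minimizer_grad0 da az0) erefl (db z0) erefl) e0.
have [r' r'0 Hr'] := blend_minimizer_cvg M ac bc az0 auniq r0.
near=> t => z zmin.
have t_gt0 : 0 < t by near: t; exact: nbhs_right_gt.
have tr : t < r by near: t; exact: nbhs_right_lt.
have tr' : t < r' by near: t; exact: nbhs_right_lt.
have tt0 : t < t0 by near: t; exact: nbhs_right_lt.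
have zM : `|z| <= M by apply: (Mbound t) => //; rewrite ltW.
have zz0 : `|z - z0| < r by apply: (Hr' t) => //; rewrite ltW.
have [||Hz Hv] := Hr t (z - z0) _ zz0.
- by rewrite t_gt0.
- by move=> k; rewrite addrCA subrr addr0 lerB.
rewrite addrCA subrr addr0 -/u in Hz Hv.
by split; rewrite opprD opprK addrA.
Unshelve. all: by end_near. Qed.

End Perturbation.

Theorem theorem1 (R : realType) (p d : nat)
    (dO : measure_display) (Omega : measurableType dO) (P : probability Omega R)
    (dY : measure_display) (YY : measurableType dY)
    (X : {RV P >-> p.-tuple R}) (Y : {RV P >-> YY})
    (c : 'cV[R]_d -> YY -> R)
    (Reg : nat -> set (p.-tuple R))
    (f : nat -> 'cV[R]_d -> R)
    (j : nat) (z0 : 'cV[R]_d) :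
  (* R_0 = R_1 |_| R_2, with P (X \in R_k) > 0 *)
  (forall k : nat, (k <= 2)%N -> measurable (Reg k)) ->
  Reg 0%N = Reg 1%N `|` Reg 2%N ->
  Reg 1%N `&` Reg 2%N = set0 ->
  (forall k : nat, (k <= 2)%N -> (0 < P (X @^-1` Reg k))%E) ->
  (* f_k z = E[c(z; Y) | X \in R_k], the expectations being finite *)
  (forall (k : nat) (z : 'cV[R]_d), (k <= 2)%N ->
    P.-integrable (X @^-1` Reg k) (fun w => (c z (Y w))%:E)) ->
  (forall (k : nat) (z : 'cV[R]_d), (k <= 2)%N ->
    f k z = cond_expectation P (X @^-1` Reg k) (fun w => c z (Y w))) ->
  j = 1%N \/ j = 2%N ->
  (* 1. *)
  C2 (f 0%N) -> C2 (f j) ->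
  (* 2. *)
  inf_compact (blend (f 0%N) (f j)) ->
  (* 3. *)
  is_minimizer (f 0%N) z0 ->
  (forall z, is_minimizer (f 0%N) z -> z = z0) ->
  posdef (hess (f 0%N) z0) ->
  let v (t : R) : R := min_value (blend (f 0%N) (f j) t) in
  let H : 'M[R]_d := hess (f 0%N) z0 in
  let g : 'cV[R]_d := grad (f j) z0 in
  [/\ (* the minimum defining v t is attained for small t > 0 *)
      (\forall t \near 0^'+, exists z, is_minimizer (blend (f 0%N) (f j) t) z),
      v = (fun t => (1 - t) * f 0%N z0 + t * f j z0
                    - 2^-1 * t ^+ 2 * (g^T *m invmx H *m g) 0 0)
          +o_ (0^'+) (fun t => t ^+ 2)
    & forall zj : R -> 'cV[R]_d,
        (\forall t \near 0^'+, is_minimizer (blend (f 0%N) (f j) t) (zj t)) ->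
        zj = (fun t => z0 - t *: (invmx H *m g)) +o_ (0^'+) (fun t => t)].
Proof.
move=> _ _ _ _ _ _ _ [[da _] dga] [[db _] _] [alpha [t0 [t00 _ ne [M bnd]]]].
move=> az0 auniq Hpos v H g.
have ac : continuous (f 0%N) by move=> y; exact: differentiable_continuous.
have bc : continuous (f j) by move=> y; exact: differentiable_continuous.
have Mbound t z : 0 <= t < t0 ->
    is_minimizer (blend (f 0%N) (f j) t) z -> `|z| <= M.
  move=> tt0 zmin; have [y ya] := ne t tt0.
  exact: (bnd t z tt0 (le_trans (zmin y) ya)).
have attained t : 0 < t < t0 ->
    exists z, is_minimizer (blend (f 0%N) (f j) t) z.
  move=> /andP[tpos tt0]; have tI : 0 <= t < t0 by rewrite ltW.
  apply: (@bounded_sublevel_minimizer _ _ _ alpha M).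
  - exact: blend_continuous.
  - exact: ne.
  - by move=> z; exact: bnd.
have expansion := blend_minimizer_expansion da (fun i => proj1 (dga i) z0) db
  az0 auniq Hpos t00 Mbound.
have near_attained :
    \forall t \near 0^'+, exists z, is_minimizer (blend (f 0%N) (f j) t) z.
  near=> t; apply: attained; apply/andP; split; near: t.
    exact: nbhs_right_gt.
  exact: nbhs_right_lt.
split => //.
- apply/eqaddoP => e e0.
  apply: filterS2 (expansion e e0) near_attained => t exp_t [z zmin].
  have [_] := exp_t z zmin.
  rewrite !fctE /v (min_valueE zmin) [`|t ^+ 2|]ger0_norm ?sqr_ge0//.
  congr (`|_ - _| <= _).
  by rewrite /dot mulmxA /blend; set q := (_ *m _) 0 0; ring.
- move=> zj zjmin; apply/eqaddoP => e e0.
  apply: filterS3 (expansion e e0) zjmin (nbhs_right_gt 0).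
  move=> t exp_t zmin t_gt0.
  by have [+ _] := exp_t _ zmin; rewrite !fctE [`|t|]gtr0_norm.
Unshelve. all: by end_near. Qed.
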